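(* $\mathrm{ex}^{(3)}_3(12;P)=32$ and $\mathrm{Ex}^{(3)}_3(12;P)=\{\mathrm{Co}(12)\}$. Equivalently: every 12-vertex $P$-free 3-graph that is contained neither in a full star $S^3_{12}$ nor in a copy of $K^3_6\cup K^3_6$ has at most 32 edges, with equality only for the comet $\mathrm{Co}(12)$.
   Context: All hypergraphs are 3-uniform (3-graphs); containment means containing an isomorphic copy as a sub-3-graph. $P$ is the loose 3-uniform path of length 3: vertices $a,b,c,d,e,f,g$, edges $\{a,b,c\},\{c,d,e\},\{e,f,g\}$. $K^3_m$ is the complete 3-graph on $m$ vertices, $\cup$ denotes vertex-disjoint union. $S^3_n$ is the full star on $n$ vertices (all $\binom{n-1}{2}$ triples containing a fixed center). The comet $\mathrm{Co}(n)$ is the $n$-vertex 3-graph with vertex set $\{c,h_1,h_2,h_3\}\cup R$, $|R|=n-4$, whose edges are the four triples of $\{c,h_1,h_2,h_3\}$ together with all triples $\{c,u,v\}$, $u,v\in R$; it has $4+\binom{n-4}{2}$ edges. Turán numbers of order $s$: $\mathrm{ex}^{(1)}_3(n;P)$ is the maximum number of edges of an $n$-vertex $P$-free 3-graph and $\mathrm{Ex}^{(1)}_3(n;P)$ the family of extremal ones; $\mathrm{ex}^{(s+1)}_3(n;P)$ is the maximum number of edges of an $n$-vertex $P$-free 3-graph not contained in any member of $\mathrm{Ex}^{(1)}_3(n;P)\cup\dots\cup\mathrm{Ex}^{(s)}_3(n;P)$, and $\mathrm{Ex}^{(s+1)}_3(n;P)$ is the family of those attaining it. For $n=12$: $\mathrm{Ex}^{(1)}_3(12;P)=\{S^3_{12}\}$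 and $\mathrm{Ex}^{(2)}_3(12;P)=\{K^3_6\cup K^3_6\}$. *)

(* Defs.v *)
From mathcomp Require Import all_boot.
Set Implicit Arguments. Unset Strict Implicit. Unset Printing Implicit Defensive.

Definition uniform3 (T : finType) (H : {set {set T}}) : Prop :=
  forall e, e \in H -> #|e| = 3.

Definition contains (T1 T2 : finType) (H : {set {set T2}}) (F : {set {set T1}}) : Prop :=
  exists f : T1 -> T2, injective f /\ forall e, e \in F -> f @: e \in H.

Definition iso3 (T1 T2 : finType) (F : {set {set T1}}) (H : {set {set T2}}) : Prop :=
  exists f : T1 -> T2, bijective f /\ [set f @: e | e : {set T1} in F] = H.

Definition v7 (k : nat) : 'I_7 := inord k.
Definition loosePath3 : {set {set 'I_7}} :=
  [set [set v7 0; v7 1; v7 2]; [set v7 2; v7 3; v7 4]; [set v7 4; v7 5; v7 6]].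

Definition star12 : {set {set 'I_12}} :=
  [set e : {set 'I_12} | (#|e| == 3) && (ord0 \in e)].

Definition half12 : {set 'I_12} := [set i : 'I_12 | i < 6].
Definition twoK6 : {set {set 'I_12}} :=
  [set e : {set 'I_12} | (#|e| == 3) && ((e \subset half12) || (e \subset ~: half12))].

Definition head12 : {set 'I_12} := [set i : 'I_12 | i < 4].
Definition tail12 : {set 'I_12} := [set i : 'I_12 | 4 <= i].
Definition comet12 : {set {set 'I_12}} :=
  [set e : {set 'I_12} | (#|e| == 3) &&
     ((e \subset head12) || ((ord0 \in e) && (e :\ ord0 \subset tail12)))].

(* Main.v *)
Require Import Defs.
From mathcomp Require Import all_boot.
From mathcomp Require Import fingroup perm.
Set Implicit Arguments. Unset Strict Implicit. Unset Printing Implicit Defensive.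

(** The upper bound is a case distinction on the presence of edges. Three edges form a loose path
    iff, of the three pairs, one is disjoint and two meet in exactly one vertex; so each known edge
    excludes many others, and it makes many pairs of undecided edges incompatible. A state consists
    of known and undecided edges; if all the other edges are absent and the undecided edges are
    covered by few cliques of pairwise incompatible edges, then the hypergraph has at most 31 edges.
    Branching on the presence of an edge, up to the vertex permutations that preserve the state,
    52 times reaches only states bounded in this way or contained in a star, in a copy of K6 ∪ K6,
    or in a copy of the comet. *)

(** * Permuting the vertices of a hypergraph *)

Definition relabel (T : finType) (s : {perm T}) (H : {set {set T}}) : {set {set T}} :=
  [set s @: e | e : {set T} in H].

Lemma relabelK (T : finType) (s : {perm T}) : cancel (relabel s) (relabel s^-1).
Proof.
move=> H; rewrite /relabel -imset_comp -[RHS]imset_id; apply: eq_imset => e /=.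
by rewrite -imset_comp -[RHS]imset_id; apply: eq_imset => x /=; rewrite permK.
Qed.

Lemma mem_relabel (T : finType) (s : {perm T}) (H : {set {set T}}) e :
  e \in H -> s @: e \in relabel s H.
Proof. exact: imset_f. Qed.

Lemma card_relabel (T : finType) (s : {perm T}) (H : {set {set T}}) :
  #|relabel s H| = #|H|.
Proof. by rewrite card_imset //; apply/imset_inj/perm_inj. Qed.

Lemma uniform3_relabel (T : finType) (s : {perm T}) (H : {set {set T}}) :
  uniform3 H -> uniform3 (relabel s H).
Proof.
by move=> uH _ /imsetP[e eH ->]; rewrite card_imset ?uH //; apply: perm_inj.
Qed.

Lemma contains_relabel (T1 T2 : finType) (s : {perm T2}) (H : {set {set T2}})
    (F : {set {set T1}}) :
  contains H F -> contains (relabel s H) F.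
Proof.
move=> [f [injf fF]]; exists (s \o f); split=> [|e eF].
  by apply: inj_comp injf; apply: perm_inj.
by rewrite imset_comp; apply/mem_relabel/fF.
Qed.

Lemma contains_of_relabel (T1 T2 : finType) (s : {perm T1}) (H : {set {set T2}})
    (F : {set {set T1}}) :
  contains H (relabel s F) -> contains H F.
Proof.
move=> [f [injf fF]]; exists (f \o s); split=> [|e eF].
  by apply: inj_comp injf _; apply: perm_inj.
by rewrite imset_comp; apply/fF/mem_relabel.
Qed.

Lemma iso3_relabel (T1 T2 : finType) (s : {perm T2}) (H : {set {set T2}})
    (F : {set {set T1}}) :
  iso3 F H -> iso3 F (relabel s H).
Proof.
move=> [f [bijf <-]]; exists (s \o f); split.
  by apply: bij_comp bijf; exists (s^-1)%g; [apply: permK | apply: permKV].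
by rewrite /relabel -imset_comp; apply: eq_imset => e /=; rewrite imset_comp.
Qed.

(** * Recognising a loose path by intersection sizes *)

Lemma uniq_contains_loosePath3 (T : finType) (H : {set {set T}}) a b c d e f g :
  uniq [:: a; b; c; d; e; f; g] ->
  [set a; b; c] \in H -> [set c; d; e] \in H -> [set e; f; g] \in H ->
  contains H loosePath3.
Proof.
set s := [:: a; _; _; _; _; _; _] => us H1 H2 H3.
(* The embedding reads vertex [i] off the list; the default [a] is never reached, as [i < 7]. *)
exists (fun i : 'I_7 => nth a s i); split=> [i j /eqP|x].
  by rewrite nth_uniq ?ltn_ord // => /eqP/val_inj.
by rewrite !inE -!orbA => /or3P[] /eqP->; rewrite !imsetU !imset_set1 /v7 !inordK.
Qed.

Lemma cards3_through (T : finType) (A : {set T}) c :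
  #|A| = 3 -> c \in A -> exists a b, [/\ a != b, a != c, b != c & A = [set c; a; b]].
Proof.
move=> A3 cA; have := cardsD1 c A; rewrite A3 cA => /esym/eqP.
rewrite add1n eqSS => /cards2P[a [b [ab E]]].
have E' x : x \in A :\ c = (x \in [set a; b]) by rewrite E.
have := E' a; have := E' b; rewrite !inE !eqxx orbT /=.
move=> /andP[bc _] /andP[ac _]; exists a, b; split=> //.
by rewrite -setUA -E setD1K.
Qed.

(** [B] is the middle edge: its common vertices with [A] and with [C] differ, since [A] and [C] are
    disjoint, so they are the two joints of the path. *)
Lemma contains_loosePath3P (T : finType) (H : {set {set T}}) (A B C : {set T}) :
  uniform3 H -> A \in H -> B \in H -> C \in H ->
  #|A :&: B| = 1 -> #|B :&: C| = 1 -> #|A :&: C| = 0 -> contains H loosePath3.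
Proof.
move=> uH AH BH CH /eqP/cards1P[c AB] /eqP/cards1P[e BC] /eqP; rewrite cards_eq0 => /eqP AC.
have /setIP[cA cB]: c \in A :&: B by rewrite AB set11.
have /setIP[eB eC]: e \in B :&: C by rewrite BC set11.
have AxB x : x \in A -> x \in B -> x = c.
  by move=> xA xB; apply/set1P; rewrite -AB inE xA.
have BxC x : x \in B -> x \in C -> x = e.
  by move=> xB xC; apply/set1P; rewrite -BC inE xB.
have AxC x : x \in A -> x \in C -> False.
  by move=> xA xC; have := in_set0 x; rewrite -AC inE xA xC.
have ce : c != e by apply/eqP=> E; apply: (AxC c) => //; rewrite E.
have [a [b [ab ac bc EA]]] := cards3_through (uH _ AH) cA.
have [f [g [fg fe ge EC]]] := cards3_through (uH _ CH) eC.
have [d [e' [de' dc e'c EB]]] := cards3_through (uH _ BH) cB.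
(* The vertex of [B] that is not a joint: [B] is known as [c] with [d] and [e'], and one of these
   two is the joint [e]. *)
have [d' [d'c d'e EB']] : exists d', [/\ d' != c, d' != e & B = [set c; d'; e]].
  move: eB; rewrite EB !inE eq_sym (negPf ce) /= => /orP[] /eqP E.
    by exists e'; rewrite E e'c (eq_sym e') de'; split=> //; rewrite setUAC.
  by exists d; rewrite E de' dc.
have AE x : x \in A = [|| x == c, x == a | x == b] by rewrite EA !inE orbA.
have CE x : x \in C = [|| x == e, x == f | x == g] by rewrite EC !inE orbA.
have BE x : x \in B = [|| x == c, x == d' | x == e] by rewrite EB' !inE orbA.
have inA x y : x \in A -> y \in C -> x != y.
  by move=> xA yC; apply/eqP=> E; apply: (AxC x); rewrite // E.
have inB x y : x \in A -> x != c -> y \in B -> x != y.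
  by move=> xA xc yB; apply: contra_neq xc => E; apply: AxB; rewrite // E.
have inC x y : x \in C -> x != e -> y \in B -> y != x.
  by move=> xA xc yB; rewrite eq_sym; apply: contra_neq xc => E; apply: BxC; rewrite // E.
apply: (@uniq_contains_loosePath3 _ H a b c d' e f g); last first.
- by rewrite -EC.
- by rewrite -EB'.
- suff -> : [set a; b; c] = A by [].
  by rewrite EA; apply/setP=> x; rewrite !inE; do 3 case: (_ == _).
have aA : a \in A by rewrite AE eqxx orbT.
have bA : b \in A by rewrite AE eqxx !orbT.
have fC : f \in C by rewrite CE eqxx orbT.
have gC : g \in C by rewrite CE eqxx !orbT.
have d'B : d' \in B by rewrite BE eqxx orbT.
rewrite /= !inE !negb_or ab ac bc fg ce d'e (eq_sym c d') d'c (eq_sym e f) fe (eq_sym e g) ge.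
by rewrite (inB a d') // (inB b d') // (inC f d') // (inC g d') // !inA.
Qed.

(** * Vertex sets as boolean words *)

Section Words.
Variable n : nat.
Implicit Types (A B : {set 'I_n}) (H : {set {set 'I_n}}).

(** The characteristic word; on boolean words the whole search can be evaluated by [vm_compute]. *)
Definition code A : bitseq := [seq i \in A | i <- enum 'I_n].

Lemma size_code A : size (code A) = n.
Proof. by rewrite size_map size_enum_ord. Qed.

Lemma nth_code A (i : 'I_n) : nth false (code A) i = (i \in A).
Proof. by rewrite (nth_map i) ?size_enum_ord // nth_ord_enum. Qed.

Lemma code_inj : injective code.
Proof. by move=> A B E; apply/setP=> i; rewrite -!nth_code E. Qed.

Lemma code_onto w : size w = n -> code [set i : 'I_n | nth false w i] = w.
Proof.
move=> wn; apply: (@eq_from_nth _ false) => [|i]; rewrite size_code // => lin.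
by rewrite (nth_code _ (Ordinal lin)) inE.
Qed.

Lemma count_code A : count id (code A) = #|A|.
Proof. by rewrite count_map cardE -size_filter enumT. Qed.

Definition meet (v w : bitseq) : nat := count (fun p => p.1 && p.2) (zip v w).

Lemma meet_code A B : meet (code A) (code B) = #|A :&: B|.
Proof.
rewrite /meet /code; have -> (s : seq 'I_n) :
    zip [seq i \in A | i <- s] [seq i \in B | i <- s] = [seq (i \in A, i \in B) | i <- s].
  by elim: s => //= x s ->.
rewrite count_map cardE -size_filter enumT; congr size.
by apply: eq_filter => x; rewrite /= inE.
Qed.

Definition codes H : seq bitseq := [seq code e | e <- enum H].

Lemma codesP w H : reflect (exists2 e, e \in H & w = code e) (w \in codes H).
Proof.
apply: (iffP mapP) => -[e eH ->]; exists e => //; first by rewrite mem_enum in eH.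
by rewrite mem_enum.
Qed.

Lemma mem_codes e H : (code e \in codes H) = (e \in H).
Proof. by rewrite (mem_map (@code_inj)) mem_enum. Qed.

Lemma size_codes H : size (codes H) = #|H|.
Proof. by rewrite size_map -cardE. Qed.

Lemma uniq_codes H : uniq (codes H).
Proof. by rewrite map_inj_uniq ?enum_uniq //; apply: code_inj. Qed.

Definition swap (i j : nat) (w : bitseq) : bitseq :=
  mkseq (fun k => nth false w (if k == i then j else if k == j then i else k)) (size w).

Lemma code_tperm (i j : 'I_n) A : code (tperm i j @: A) = swap i j (code A).
Proof.
apply: (@eq_from_nth _ false) => [|k]; rewrite ?size_mkseq !size_code // => ltkn.
rewrite nth_mkseq ?size_code // (nth_code _ (Ordinal ltkn)).
(* A transposition is its own inverse, so membership in the image is tested at the swapped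
   position. *)
have -> : (Ordinal ltkn \in tperm i j @: A) = (tperm i j (Ordinal ltkn) \in A).
  by rewrite -{1}(tpermK i j (Ordinal ltkn)) mem_imset //; apply: perm_inj.
rewrite -nth_code; congr nth.
case: tpermP => [<- | <- | ki kj] /=; rewrite ?eqxx //.
  by case: eqP => [->|].
case: eqP => [/(@val_inj _ _ 'I_n (Ordinal _))|_] //.
by case: eqP => [/(@val_inj _ _ 'I_n (Ordinal _))|].
Qed.

Lemma codes_tperm (i j : 'I_n) H w :
  w \in codes (relabel (tperm i j) H) <-> exists2 v, v \in codes H & w = swap i j v.
Proof.
split=> [/codesP[_ /imsetP[e eH ->] ->]|[_ /codesP[e eH ->] ->]].
  by exists (code e); rewrite ?mem_codes ?code_tperm.
by rewrite -code_tperm mem_codes mem_relabel.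
Qed.

Definition inside (P : pred nat) (w : bitseq) : bool :=
  all (fun i => nth false w i ==> P i) (iota 0 (size w)).

Lemma inside_code P A : inside P (code A) = (A \subset [set i : 'I_n | P i]).
Proof.
rewrite /inside size_code; apply/allP/subsetP => [inP i iA | sAP i iA].
  by have := inP i; rewrite mem_iota ltn_ord nth_code iA inE => /(_ isT).
move: iA; rewrite mem_iota => /= ltin; rewrite (nth_code _ (Ordinal ltin)).
by apply/implyP=> /sAP; rewrite inE.
Qed.
End Words.

Fixpoint words (n k : nat) : seq bitseq :=
  if n is m.+1 then
    (if k is l.+1 then map (cons true) (words m l) else [::]) ++ map (cons false) (words m k)
  else if k is 0 then [:: [::]] else [::].

Lemma mem_words n k w : (w \in words n k) = (size w == n) && (count id w == k).
Proof.
elim: n k w => [|n IHn] k [|b w] /=; try by case: k.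
  by rewrite mem_cat; case: k => [|k]; rewrite ?orFb; do ?case: mapP => [[]|_] //.
have cons_inj c : injective (cons c : bitseq -> bitseq) by move=> ? ? [].
have consN a c v (s : seq bitseq) : a != c -> (a :: v \in map (cons c) s) = false.
  by move=> ac; apply/mapP => -[x _ [E]]; rewrite E eqxx in ac.
case: b; rewrite mem_cat eqSS; case: k => [|k].
- by rewrite in_nil consN // add1n andbF.
- by rewrite (consN true false) // orbF mem_map // IHn eqSS.
- by rewrite in_nil mem_map // IHn.
by rewrite (consN false true) // mem_map // IHn.
Qed.

(** The test is insensitive to the order of the edges: any of the three may be the middle one. *)
Definition loose (u v w : bitseq) : bool :=
  match meet u v with
  | 0 => (meet u w == 1) && (meet v w == 1)
  | 1 => meet u w + meet v w == 1
  | _ => false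
  end.

Lemma contains_of_loose n (H : {set {set 'I_n}}) u v w : uniform3 H ->
  u \in codes H -> v \in codes H -> w \in codes H -> loose u v w ->
  contains H loosePath3.
Proof.
move=> uH /codesP[A AH ->] /codesP[B BH ->] /codesP[C CH ->].
have P := contains_loosePath3P uH.
rewrite /loose !meet_code; case EAB: #|A :&: B| => [|[|//]].
  by move=> /andP[/eqP EAC /eqP EBC]; apply: (P A C B); rewrite // setIC.
case EAC: #|A :&: C| => [|[|//]]; rewrite ?add0n => /eqP EBC.
  by apply: (P A B C).
by case: EBC => EBC; apply: (P B A C); rewrite // setIC.
Qed.

(** * Greedy clique covers *)

Section CliqueCover.
Variables (T : Type) (c : rel T).

Fixpoint insert (x : T) (Ks : seq (seq T)) : seq (seq T) :=
  if Ks is K :: Ks' then if all (c x) K then (x :: K) :: Ks' else K :: insert x Ks'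
  else [:: [:: x]].

Definition clique_cover (s : seq T) : seq (seq T) := foldr insert [::] s.

Variable h : pred T.
Hypothesis independent_h : forall x y, h x -> h y -> ~~ c x y.

(** An independent set has at most one element in each clique, so any cover, however far from
    optimal, gives a valid bound. *)
Lemma count_clique_cover s : count h s <= size (clique_cover s).
Proof.
(* Induction needs both facts: each class has at most one element of [h], and no element of [h] is
   lost in the classes. *)
suff: all (fun K => count h K <= 1) (clique_cover s) /\
      count h s = count h (flatten (clique_cover s)).
  case=> + ->; elim: (clique_cover s) => //= K Ks IH /andP[K1 /IH Ks1].
  by rewrite count_cat -add1n leq_add.
elim: s => //= x s [+ ->]; elim: (clique_cover s) => [|K Ks IH] /=.
  by case: (h x).
move=> /andP[K1 Ks1]; have [cxK|_] /= := boolP (all (c x) K).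
  rewrite Ks1 andbT; split=> //; case hx: (h x) => //=.
  suff /eqP-> : count h K == 0 by [].
  rewrite -leqn0 leqNgt -has_count; apply/negP.
  elim: K cxK {K1} => //= y K IHK /andP[cxy cxK] /orP[hy|]; last exact: IHK.
  by move: cxy; apply/negP/independent_h.
have [Ks1' E] := IH Ks1; rewrite K1 Ks1' !count_cat -E; split=> //.
by rewrite addnCA.
Qed.
End CliqueCover.

(** * The star, the two complete graphs and the comet on words *)

Definition star_word (w : bitseq) := nth false w 0.
Definition twoK6_word (w : bitseq) := inside (fun i => i < 6) w || inside (fun i => 6 <= i) w.
Definition comet_word (w : bitseq) :=
  inside (fun i => i < 4) w || nth false w 0 && inside (fun i => (i == 0) || (4 <= i)) w.

Lemma star12_code (e : {set 'I_12}) : #|e| = 3 -> (e \in star12) = star_word (code e).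
Proof. by move=> e3; rewrite inE e3 -nth_code. Qed.

Lemma twoK6_code (e : {set 'I_12}) : #|e| = 3 -> (e \in twoK6) = twoK6_word (code e).
Proof.
move=> e3; rewrite inE e3 /twoK6_word !inside_code.
by have -> : ~: half12 = [set i : 'I_12 | 6 <= i] by apply/setP=> i; rewrite !inE -leqNgt.
Qed.

Lemma comet12_code (e : {set 'I_12}) : #|e| = 3 -> (e \in comet12) = comet_word (code e).
Proof.
move=> e3; rewrite inE e3 /comet_word !inside_code -nth_code subDset.
by have -> : [set ord0] :|: tail12 = [set i : 'I_12 | (i == 0 :> nat) || (4 <= i)]
  by apply/setP=> i; rewrite !inE.
Qed.

Definition comet_words := [seq w <- words 12 3 | comet_word w].

Lemma codes_comet12 : codes comet12 =i comet_words.
Proof.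
move=> w; rewrite mem_filter mem_words.
apply/codesP/andP=> [[e eC ->]|[wC /andP[/eqP w12 /eqP w3]]].
  have e3 : #|e| = 3 by move: eC; rewrite inE => /andP[/eqP].
  by rewrite -comet12_code // size_code count_code e3.
have wE := code_onto w12; exists [set i : 'I_12 | nth false w i] => //.
by rewrite comet12_code ?wE // -count_code wE.
Qed.

Lemma card_comet12 : #|comet12| = 32.
Proof.
rewrite -size_codes; have /perm_size-> : perm_eq (codes comet12) comet_words;
  last by vm_compute.
by apply: uniq_perm codes_comet12; rewrite ?uniq_codes //; vm_compute.
Qed.

(** * Hypotheses and conclusion are invariant under relabelling *)

Definition admissible (H : {set {set 'I_12}}) : Prop :=
  [/\ uniform3 H, ~ contains H loosePath3, ~ contains star12 H & ~ contains twoK6 H].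

Definition small_or_comet (H : {set {set 'I_12}}) : Prop :=
  #|H| <= 32 /\ (#|H| = 32 -> iso3 comet12 H).

Lemma admissible_relabel (s : {perm 'I_12}) H : admissible H -> admissible (relabel s H).
Proof.
move=> [uH pH sH kH]; split; first exact: uniform3_relabel.
- by move=> /(@contains_relabel _ _ s^-1); rewrite relabelK.
- by move=> /contains_of_relabel.
- by move=> /contains_of_relabel.
Qed.

Lemma small_or_comet_relabel (s : {perm 'I_12}) H :
  small_or_comet (relabel s H) -> small_or_comet H.
Proof.
rewrite /small_or_comet card_relabel => -[H32 isoH]; split=> // /isoH.
by move=> /(@iso3_relabel _ _ s^-1); rewrite relabelK.
Qed.

(** * States, symmetries and the certificate checker *)

Definition consistent (H : {set {set 'I_12}}) (ins unk : seq bitseq) : Prop :=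
  {subset ins <= codes H} /\ {subset codes H <= ins ++ unk}.

(** Only transpositions of neighbouring labels are tried; they generate all permutations within runs
    of interchangeable labels, and sorting within the runs picks an orbit representative. *)
Definition symmetries (ins unk : seq bitseq) : seq nat :=
  [seq i <- iota 0 11 | all (fun w => swap i i.+1 w \in ins) ins
                     && all (fun w => swap i i.+1 w \in unk) unk].

Definition bubble (i : nat) (w : bitseq) : bitseq :=
  if ~~ nth false w i && nth false w i.+1 then swap i i.+1 w else w.

(* One pass brings the first unsorted vertex of each orbit into place, and an edge has three. *)
Definition normalize (gens : seq nat) (w : bitseq) : bitseq :=
  iter 3 (fun v => foldr bubble v gens) w.

Definition word (a b c : nat) : bitseq := [seq i \in [:: a; b; c] | i <- iota 0 12].

(* [Swap i j t] exchanges two vertex labels, to bring the state into the fixed [twoK6] or [comet12].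
   [Split a b c t u] continues with [t] when the edge [abc] or one of its images under the
   symmetries is present, and with [u] when they are all absent. *)
Inductive tree :=
  | Few | InStar | InTwoK6 | InComet
  | Swap of nat & nat & tree
  | Split of nat & nat & nat & tree & tree.

(** Such [v] and [w] complete a known edge to a loose path, so at most one of them is present. *)
Definition conflict (ins : seq bitseq) (v w : bitseq) : bool := has (fun u => loose u v w) ins.

(** When [e] is added in a [Split], the undecided edges that form a loose path with [e] and an older
    known edge are dropped; in the other branch the orbit of [e] is dropped. *)
Fixpoint verify (t : tree) (ins unk : seq bitseq) : bool :=
  match t with
  | Few => size ins + size (clique_cover (conflict ins) unk) < 32
  | InStar => all star_word (ins ++ unk)
  | InTwoK6 => all twoK6_word (ins ++ unk)
  | InComet => all comet_word (ins ++ unk)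
  | Swap i j t' =>
      [&& i < 12, j < 12 & verify t' (map (swap i j) ins) (map (swap i j) unk)]
  | Split a b c t1 t2 =>
      let e := word a b c in
      let gens := symmetries ins unk in
      verify t1 (e :: ins) [seq w <- unk | (w != e) && ~~ conflict ins e w]
      && verify t2 ins [seq w <- unk | normalize gens w != e]
  end.

(** The first splits ask for an edge 012, for an edge meeting it in one vertex, and for a third one
    closing a loose triangle. If no edge meets 012 in exactly one vertex, the next question is for
    an edge disjoint from it. *)
Definition search_tree : tree :=
  (Split 0 1 2
    (Split 0 3 4
      (Split 1 3 5
        (Split 0 5 6 Few
        (Split 0 1 6 Few
        (Split 0 3 6 Few
        (Split 1 3 6 Few
        (Split 1 4 6 Few
        (Split 2 3 6 Few
        InTwoK6))))))
      (Split 5 6 7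
        (Split 1 2 5 Few
        (Split 3 4 5 Few
        (Split 5 8 9
          (Split 0 6 7 Few
          (Split 0 8 9 Few
          (Split 0 10 11 Few
          (Split 5 10 11 Few
          (Split 6 8 10
            (Split 0 1 11 (Swap 5 11 InTwoK6)
            (Split 0 3 11 (Swap 5 11 InTwoK6)
            (Split 1 2 11 (Swap 5 11 InTwoK6)
            Few)))
          (Split 0 1 10
            (Split 0 3 11 Few
            (Split 5 6 11 (Swap 5 10 InTwoK6)
            Few))
          (Split 0 3 10 Few
          Few)))))))
        (Split 5 6 8 Few
        (Split 1 2 8 Few
        (Split 3 4 8 Few
        (Split 8 9 10 Few
        (Split 0 8 9 (Swap 1 5 (Swap 2 6 (Swap 3 7 InComet)))
        Few))))))))
      (Split 1 2 3 Few
      (Split 1 3 4 Few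
      (Split 1 2 5
        (Split 1 2 6 Few
        (Split 3 4 6 Few
        (Split 0 1 3 Few
        (Split 0 3 5 Few
        (Split 0 3 6 (Swap 3 5 InComet)
        Few)))))
      (Split 3 4 5
        (Split 3 4 6 Few
        (Split 0 6 7 (Swap 1 4 (Swap 2 5 InComet))
        Few))
      InStar))))))
    (Split 3 4 5
      (Split 3 6 7
        (Split 4 5 8 Few
        (Split 4 6 8 Few
        (Split 0 1 8 Few
        (Split 6 7 8 Few
        (Split 8 9 10 Few
        (Split 3 8 9 (Swap 0 3 InComet)
        Few))))))
      (Split 0 1 6
        (Split 3 4 7 Few
        Few)
      (Split 6 7 8 Few
      Few)))
    Few))
  Few).

(** * Soundness of the checker *)

Lemma consistent_swap (i j : 'I_12) H ins unk : consistent H ins unk ->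
  consistent (relabel (tperm i j) H) (map (swap i j) ins) (map (swap i j) unk).
Proof.
move=> [insH Hunk]; split=> w.
  by case/mapP=> v /insH vH ->; apply/codes_tperm; exists v.
by case/codes_tperm=> v /Hunk vH ->; rewrite -map_cat map_f.
Qed.

Lemma consistent_symmetry (i j : 'I_12) H ins unk :
  all (fun w => swap i j w \in ins) ins -> all (fun w => swap i j w \in unk) unk ->
  consistent H ins unk -> consistent (relabel (tperm i j) H) ins unk.
Proof.
move=> /allP sins /allP sunk [insH Hunk]; split=> w.
  move=> wins; have /codesP[e eH E] := insH w wins.
  have /insH := sins w wins; rewrite E -code_tperm mem_codes => eH'.
  (* The known edge [e] is the image of its own image, which is again known and hence in [H]. *)
  have -> : e = tperm i j @: (tperm i j @: e).
    by rewrite -imset_comp -[LHS]imset_id; apply: eq_imset => x /=; rewrite tpermK.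
  by rewrite mem_codes mem_relabel.
case/codes_tperm=> v /Hunk; rewrite !mem_cat => /orP[/sins|/sunk] + -> => -> //.
by rewrite orbT.
Qed.

(** Each step of the sorting is the identity or a swap from [gens], so a property that can be pulled
    back along these swaps can be pulled back from the normal form. *)
Lemma normalize_ind (P : bitseq -> Prop) gens :
  (forall i w, i \in gens -> P (swap i i.+1 w) -> P w) ->
  forall w, P (normalize gens w) -> P w.
Proof.
move=> Pswap; have pass s w : {subset s <= gens} -> P (foldr bubble w s) -> P w.
  elim: s => //= i s IHs sub Pw; apply: IHs => [j js|]; first by rewrite sub // inE js orbT.
  by move: Pw; rewrite {1}/bubble; case: ifP => // _; apply/Pswap/sub/mem_head.
by move=> w; do 3! move/(pass gens _ (fun _ => id)).
Qed.

(** Induction on the tree, with the hypergraph generalised because swaps and symmetries replace it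
    by a relabelled copy. *)
Lemma verifyP t ins unk H : verify t ins unk -> admissible H -> consistent H ins unk ->
  small_or_comet H.
Proof.
elim: t ins unk H => [||||i j t IHt|a b c t1 IH1 t2 IH2] ins unk H /=.
- move=> few [uH pH _ _] [insH Hunk].
  have H31 : #|H| < 32.
    apply: leq_ltn_trans few; rewrite -size_codes.
    apply: (@leq_trans (count (mem (codes H)) (ins ++ unk))).
      rewrite -size_filter uniq_leq_size ?uniq_codes // => w wH.
      by rewrite mem_filter /= wH Hunk.
    (* Edges of [H] are pairwise free of conflicts, so each clique of undecided edges contributes at
       most one. *)
    rewrite count_cat leq_add ?count_size //; apply: count_clique_cover => v w vH wH.
    by apply/hasPn=> u /insH uH'; apply/negP=> /(contains_of_loose uH uH' vH wH)/pH.
  by split; [apply: ltnW | move=> E; rewrite E ltnn in H31].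
- move=> /allP st [uH _ sH _] [_ Hunk]; case: sH; exists id; split=> // e eH.
  by rewrite imset_id star12_code ?uH // st // Hunk // mem_codes.
- move=> /allP st [uH _ _ kH] [_ Hunk]; case: kH; exists id; split=> // e eH.
  by rewrite imset_id twoK6_code ?uH // st // Hunk // mem_codes.
- move=> /allP st [uH _ _ _] [_ Hunk].
  have sH : H \subset comet12.
    by apply/subsetP=> e eH; rewrite comet12_code ?uH // st // Hunk // mem_codes.
  split=> [|H32]; first by rewrite -card_comet12 subset_leq_card.
  have -> : H = comet12 by apply/eqP; rewrite eqEcard sH H32 card_comet12.
  exists id; split; first exact: inv_bij.
  by rewrite -[RHS]imset_id; apply: eq_imset => e; rewrite imset_id.
- move=> /and3P[lti ltj vt] aH cH.
  apply: (@small_or_comet_relabel (tperm (Ordinal lti) (Ordinal ltj))).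
  apply: (IHt _ _ _ vt); first exact: admissible_relabel.
  exact: (consistent_swap (Ordinal lti) (Ordinal ltj)).
move=> /andP[/IH1{}IH1 /IH2{}IH2] aH cH.
pose e := word a b c; pose gens := symmetries ins unk.
(* Quantifying over every [G] in the same state makes [closed] pass along symmetries, which change
   the hypergraph but keep the state. *)
pose closed w :=
  forall G, admissible G -> consistent G ins unk -> w \in codes G -> small_or_comet G.
have closed_swap i v : i \in gens -> closed (swap i i.+1 v) -> closed v.
  rewrite mem_filter mem_iota => /andP[/andP[sins sunk] /= lti] cv G aG cG vG.
  have lti1 : i < 12 by apply: ltnW.
  apply: (@small_or_comet_relabel (tperm (Ordinal lti1) (Ordinal (lti : i.+1 < 12)))).
  apply: cv; first exact: admissible_relabel.
    exact: consistent_symmetry.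
  by apply/codes_tperm; exists v.
have closed_e : closed e.
  move=> G aG [insG Gunk] eG; apply: IH1 => //; split=> v.
    by rewrite inE => /predU1P[->|/insG].
  move=> vG; have := Gunk v vG; rewrite !(inE, mem_cat, mem_filter).
  have [//|_ /=] := eqVneq v e; case/orP=> [->//|->]; rewrite andbT; apply/orP; right.
  apply/hasPn=> u /insG uG; case: aG => uniG pG _ _; apply/negP.
  by move=> /(contains_of_loose uniG uG eG vG)/pG.
(* Either some edge normalises to [e], and a symmetric copy of [H] contains [e], or the edges
   removed from [unk] are all absent. *)
have [/hasP[w wH /eqP we]|/hasPn absent] := boolP (has (fun w => normalize gens w == e) (codes H)).
  by apply: (normalize_ind closed_swap (w := w)) wH => //; rewrite we.
apply: IH2 => //; case: cH => insH Hunk; split=> // w wH.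
by have := Hunk w wH; rewrite !mem_cat mem_filter (absent w wH).
Qed.

Lemma search_tree_verified : verify search_tree [::] (words 12 3).
Proof. by vm_compute. Qed.

(** * Admissibility of the comet *)

Lemma comet12_edgeP (w : bitseq) :
  w \in comet_words -> exists2 e : {set 'I_12}, e \in comet12 & w = code e.
Proof. by rewrite -codes_comet12 => /codesP. Qed.

Lemma uniform3_comet12 : uniform3 comet12.
Proof. by move=> e; rewrite inE => /andP[/eqP]. Qed.

Lemma v7E k (x : 'I_7) : k < 7 -> (x == v7 k) = (x == k :> nat).
Proof. by move=> k7; rewrite -val_eqE /= inordK. Qed.

Lemma comet12_loosePath3_free : ~ contains comet12 loosePath3.
Proof.
case=> f [injf fP].
have fcode e : e \in loosePath3 -> code (f @: e) \in comet_words.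
  by move=> /fP; rewrite -codes_comet12 mem_codes.
set A := [set v7 0; v7 1; v7 2]; set B := [set v7 2; v7 3; v7 4].
set C := [set v7 4; v7 5; v7 6].
have AP : A \in loosePath3 by apply/setUP; left; apply/set2P; left.
have BP : B \in loosePath3 by apply/setUP; left; apply/set2P; right.
have CP : C \in loosePath3 by apply/setUP; right; apply/set1P.
have meetf (X Y : {set 'I_7}) : meet (code (f @: X)) (code (f @: Y)) = #|X :&: Y|.
  by rewrite meet_code -imsetI ?card_imset // => x y _ _; apply: injf.
have AB : A :&: B = [set v7 2].
  by apply/setP=> x; rewrite !inE !v7E //; case: x => -[|[|[|[|[|[|[|]]]]]]].
have BC : B :&: C = [set v7 4].
  by apply/setP=> x; rewrite !inE !v7E //; case: x => -[|[|[|[|[|[|[|]]]]]]].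
have AC : A :&: C = set0.
  by apply/setP=> x; rewrite !inE !v7E //; case: x => -[|[|[|[|[|[|[|]]]]]]].
(* All triples of comet edges are checked by evaluation; the images of the three path edges would
   violate this, since an injection preserves intersection sizes. *)
have noloose : all (fun u => all (fun v => all (fun w => ~~ loose u v w)
    comet_words) comet_words) comet_words by vm_compute.
move/allP/(_ _ (fcode A AP))/allP/(_ _ (fcode B BP))/allP/(_ _ (fcode C CP)): noloose.
by rewrite /loose !meetf AB BC AC !cards1 cards0.
Qed.

Lemma comet12_not_in_star12 : ~ contains star12 comet12.
Proof.
case=> f [injf fS].
have center e : e \in comet12 -> exists2 x, x \in e & f x = ord0.
  by move=> /fS; rewrite inE => /andP[_ /imsetP[x xe ->]]; exists x.
(* Two disjoint comet edges, one in the head and one through the center and the tail; they cannot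
   share the preimage of the star's center. *)
have [//|e1 /center[x xe1 fx] E1] := @comet12_edgeP (word 1 2 3).
have [//|e2 /center[y ye2 fy] E2] := @comet12_edgeP (word 0 4 5).
have xy : x = y by apply: injf; rewrite fx fy.
have /eqP : #|e1 :&: e2| = 0 by rewrite -meet_code -E1 -E2.
by rewrite cards_eq0 => /eqP E; have := in_set0 x; rewrite -E inE xe1 xy ye2.
Qed.

Lemma comet12_not_in_twoK6 : ~ contains twoK6 comet12.
Proof.
case=> f [injf fK].
(* Every vertex shares an edge with the center, so all vertices go to the same side. *)
have covered :
    all (fun i => has (fun w => nth false w 0 && nth false w i) comet_words) (iota 0 12).
  by vm_compute.
have sameside (S : {set 'I_12}) : S = half12 \/ S = ~: half12 -> f ord0 \in S ->
    forall i, f i \in S.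
  move=> defS S0 i; have iI : (i : nat) \in iota 0 12 by rewrite mem_iota ltn_ord.
  have /hasP[w wC] := allP covered _ iI; have [e eC ->] := comet12_edgeP wC.
  rewrite (nth_code e ord0) nth_code => /andP[e0 ei].
  have := fK e eC; rewrite inE => /andP[_ /orP[]] /subsetP fe;
    have f0 := fe _ (imset_f f e0); have fi := fe _ (imset_f f ei);
    by case: defS S0 => -> //; rewrite !inE in f0 fi *; rewrite ?f0 ?fi // (negPf f0).
have half6 : #|half12| = 6.
  rewrite -count_code /code; under eq_map => i do rewrite inE.
  by rewrite (map_comp (fun k => k < 6) val) val_enum_ord.
have small (S : {set 'I_12}) : S = half12 \/ S = ~: half12 -> #|S| = 6.
  by case=> ->; rewrite ?half6 //; have := cardsC half12; rewrite half6 card_ord => -[].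
have [S defS S0] : exists2 S, S = half12 \/ S = ~: half12 & f ord0 \in S.
  have [h|h] := boolP (f ord0 \in half12); first by exists half12; [left|].
  by exists (~: half12); [right | rewrite inE].
(* Twelve vertices would be mapped injectively into a side of six. *)
have : #|f @: [set: 'I_12]| <= #|S|.
  by apply/subset_leq_card/subsetP=> _ /imsetP[i _ ->]; apply: sameside.
by rewrite card_imset // cardsT card_ord small.
Qed.

(** * The third-order Turán number on twelve vertices *)

Theorem mainTheorem3 :
  (* the comet Co(12) is admissible (P-free, not in a star, not in K6 ∪ K6) with 32 edges *)
  (uniform3 comet12 /\ ~ contains comet12 loosePath3 /\
   ~ contains star12 comet12 /\ ~ contains twoK6 comet12 /\ #|comet12| = 32) /\
  (* every admissible 12-vertex 3-graph has at most 32 edges, with equality only for Co(12) *)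
  (forall H : {set {set 'I_12}},
     uniform3 H -> ~ contains H loosePath3 ->
     ~ contains star12 H -> ~ contains twoK6 H ->
     #|H| <= 32 /\ (#|H| = 32 -> iso3 comet12 H)).
Proof.
split.
  split; first exact: uniform3_comet12.
  split; first exact: comet12_loosePath3_free.
  split; first exact: comet12_not_in_star12.
  by split; [exact: comet12_not_in_twoK6 | exact: card_comet12].
(* The search starts with no known edge and all 220 triples undecided, a state consistent with every
   3-graph. *)
move=> H uH pH sH kH; apply: (verifyP search_tree_verified) => //.
split=> // _ /codesP[e eH ->].
by rewrite mem_words size_code count_code uH.
Qed.
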